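(* Let $\Gamma_M$ ($M>0$) be a family of nonatomic routing games with a single OD pair, sharing the same graph, path set $\mathcal P$ and edge cost functions $(c_e)_{e\in\mathcal E}$, where $M$ is the traffic demand of the OD pair. Suppose there is a function $c:(0,\infty)\to(0,\infty)$, regularly varying at $0$, which is a benchmark for $(c_e)_{e\in\mathcal E}$ at $0$, and that the network is tight relative to $c$ at $0$, i.e. $0<\alpha<\infty$ where $\alpha=\min_{p\in\mathcal P}\max_{e\in p}\alpha_e$ and $\alpha_e=\lim_{x\to 0}c_e(x)/c(x)$. Then $\lim_{M\to 0}\mathrm{PoA}(\Gamma_M)=1$.
   Context: A nonatomic routing game consists of: a finite directed multigraph with edge set $\mathcal E$; a finite set $\mathcal I$ of origin–destination (OD) pairs, each $i\in\mathcal I$ with a demand $m^i\ge 0$ and a nonempty finite set $\mathcal P^i$ of paths (sequences of edges) from its origin to its destination, the sets $\mathcal P^i$ pairwise disjoint, $\mathcal P=\bigcup_i\mathcal P^i$; and for each edge $e$ a continuous nondecreasing cost function $c_e:[0,\infty)\to[0,\infty)$. The total inflow is $M=\sum_i m^i>0$. A feasible flow is $f\in\mathbb R_+^{\mathcal P}$ with $\sum_{p\in\mathcal P^i}f_p=m^i$ for all $i$; it induces loads $x_e=\sum_{p\ni e}f_p$ and path costs $c_p(f)=\sum_{e\in p}c_e(x_e)$. A Wardrop equilibrium is a feasible flow $f^*$ with $c_p(f^* )\le c_{p'}(f^* )$ for all $i$ and all $p,p'\in\mathcal P^i$ with $f^*_p>0$. The social cost of a load profile is $L(x)=\sum_e x_e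 c_e(x_e)$; $\mathrm{Opt}(\Gamma)$ is the minimum of $L$ over loads induced by feasible flows, and $\mathrm{Eq}(\Gamma)=L(x^* )$ for the load $x^*$ of a Wardrop equilibrium (all equilibria have the same social cost). The price of anarchy is $\mathrm{PoA}(\Gamma)=\mathrm{Eq}(\Gamma)/\mathrm{Opt}(\Gamma)$; it is assumed throughout that $\mathrm{Opt}(\Gamma)>0$ (if $\mathrm{Opt}(\Gamma)=0$ one sets $\mathrm{PoA}=1$). For $\omega\in\{0,\infty\}$, a function $g:(0,\infty)\to(0,\infty)$ is regularly varying at $\omega$ if $\lim_{t\to\omega}g(tx)/g(t)$ exists and is finite and nonzero for every $x>0$. A regularly varying function $c$ at $\omega$ is a benchmark for the costs $(c_e)$ at $\omega$ if the (possibly infinite) limit $\alpha_e=\lim_{x\to\omega}c_e(x)/c(x)\in[0,\infty]$ exists for every edge $e$. *)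

(* Defs.v *)
From HB Require Import structures.
From mathcomp Require Import all_boot all_order all_algebra.
From mathcomp Require Import all_classical all_reals all_analysis.
Set Implicit Arguments. Unset Strict Implicit. Unset Printing Implicit Defensive.
Import Order.TTheory GRing.Theory Num.Theory.
Import numFieldNormedType.Exports.
Local Open Scope classical_set_scope.
Local Open Scope ring_scope.

Section Routing.
Variables (R : realType) (V E : finType).

Definition is_od_path (tl hd : E -> V) (o d : V) (p : seq E) : bool :=
  if p is e :: p' then
    [&& tl e == o, hd (last e p') == d & path (fun e1 e2 => hd e1 == tl e2) e p']
  else false.

Variables (P : seq (seq E)) (ce : E -> R -> R).

Definition load (f : seq E -> R) (e : E) : R := \sum_(p <- P | e \in p) f p.

Definition pcost (f : seq E -> R) (p : seq E) : R :=
  \sum_(e : E | e \in p) ce e (load f e).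

Definition feasible (M : R) (f : seq E -> R) : Prop :=
  (forall p, p \in P -> 0 <= f p) /\ \sum_(p <- P) f p = M.

Definition wardrop (M : R) (f : seq E -> R) : Prop :=
  feasible M f /\
  forall p p', p \in P -> p' \in P -> 0 < f p -> pcost f p <= pcost f p'.

Definition social (f : seq E -> R) : R :=
  \sum_(e : E) load f e * ce e (load f e).

Definition opt (M : R) : R := inf [set social f | f in [set f | feasible M f]].

(* price of anarchy, computed from an equilibrium flow f (Eq = social f);
   convention PoA = 1 when Opt = 0 *)
Definition poa (M : R) (f : seq E -> R) : R :=
  if opt M == 0 then 1 else social f / opt M.

End Routing.

Definition cost_fun (R : realType) (g : R -> R) : Prop :=
  {within [set x : R | 0 <= x], continuous g} /\
  (forall x y, 0 <= x -> x <= y -> g x <= g y) /\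
  (forall x, 0 <= x -> 0 <= g x).

Definition regvar0 (R : realType) (g : R -> R) : Prop :=
  forall x : R, 0 < x ->
    exists l : R, l != 0 /\ (fun t => g (t * x) / g t) @ 0^'+ --> l.

Definition tightness (R : realType) (E : finType) (P : seq (seq E))
  (alpha : E -> \bar R) : \bar R :=
  \big[mine/+oo%E]_(p <- P) \big[maxe/-oo%E]_(e : E | e \in p) alpha e.

(* Main.v *)
(* As M -> 0 the cost c_e(tx) / c(t) tends to alpha_e x^rho for some
   rho >= 0 common to all edges, and for such monomials the tangent inequality
     (1 + rho) z x^rho <= z z^rho + rho x x^rho
   makes equilibria optimal. The tangent inequality survives on each edge up to an
   error eps M c(M), uniformly over loads x, z in [0, M]; on edges with
   alpha_e = oo it survives because c_e there dominates the equilibrium path cost,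
   which tightness bounds by K c(M). Summing over edges and applying the
   variational inequality of the equilibrium shows that every feasible flow costs
   at least Eq - O(eps M c(M)), while tightness gives Eq >= kappa M c(M). *)
Require Import Defs.
From HB Require Import structures.
From mathcomp Require Import all_boot all_order all_algebra.
From mathcomp Require Import all_classical all_reals all_analysis.
From mathcomp Require Import ring lra.
Set Implicit Arguments. Unset Strict Implicit. Unset Printing Implicit Defensive.
Import Order.TTheory GRing.Theory Num.Theory.
Import numFieldNormedType.Exports.
Local Open Scope classical_set_scope.
Local Open Scope ring_scope.

(** * Monotone functional equations and the tangent inequality for powers *)

Lemma additive_nondecreasing_linear (R : realType) (phi : R -> R) :
  {morph phi : x y / x + y} -> {homo phi : x y / x <= y} ->
  forall x, phi x = x * phi 1.
Proof.
move=> phiD phi_nd.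
have phi0 : phi 0 = 0 by have := phiD 0 0; rewrite addr0; lra.
have phiN x : phi (- x) = - phi x by have := phiD x (- x); rewrite subrr phi0; lra.
have phiMn x n : phi (x *+ n) = phi x *+ n.
  by elim: n => [|n IH]; rewrite ?mulr0n // !mulrS phiD IH.
suff phi_ge0 x : 0 <= x -> phi x = x * phi 1.
  move=> x; case: (lerP 0 x) => [/phi_ge0//|x0].
  by apply/eqP; rewrite -eqr_opp -phiN phi_ge0 ?mulNr ?oppr_ge0 // ltW.
move=> x0; apply/eqP; rewrite -subr_eq0 -normr_eq0 eq_le normr_ge0 andbT.
have p1 : 0 <= phi 1 by rewrite -phi0 phi_nd.
(* With [k] the integer part of [x *+ n], both [phi (x *+ n)] and [(x *+ n) * phi 1] lie between
   [k * phi 1] and [(k + 1) * phi 1]; letting [n] grow then forces the difference to vanish. *)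
have key n : n%:R * `|phi x - x * phi 1| <= phi 1.
  have n0 : (0 : R) <= n%:R by rewrite ler0n.
  rewrite -[n%:R * _](_ : `|phi (x *+ n) - (x *+ n) * phi 1| = _); last first.
    by rewrite mulr_natl phiMn mulrnAl -mulrnBl normrMn.
  have /truncn_itv : 0 <= x *+ n by rewrite mulrn_wge0.
  set k := Num.trunc _ => /andP[k1 /ltW k2].
  have := phi_nd _ _ k1; have := phi_nd _ _ k2.
  have phi_nat j : phi j%:R = j%:R * phi 1 by rewrite phiMn mulr_natl.
  rewrite !phi_nat ler_distl; move: (x *+ n) k1 k2 => y k1 k2.
  have := ler_wpM2r p1 k1; have := ler_wpM2r p1 k2; rewrite -natr1; lra.
rewrite leNgt; apply/negP => y0.
set y := `|_| in key y0.
have := key (Num.trunc (phi 1 / y)).+1.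
have /truncn_itv/andP[_] : 0 <= phi 1 / y by rewrite divr_ge0 // ltW.
by rewrite ltr_pdivrMr // => /lt_le_trans h /h; rewrite ltxx.
Qed.

(** Conjugating by [expR] and [ln] gives the additive equation, so [rho] is [ln (l (expR 1))]. *)
Lemma multiplicative_nondecreasing_powR (R : realType) (l : R -> R) :
  (forall x, 0 < x -> 0 < l x) ->
  (forall x y, 0 < x -> 0 < y -> l (x * y) = l x * l y) ->
  (forall x y, 0 < x -> x <= y -> l x <= l y) ->
  exists2 rho, 0 <= rho & forall x, 0 < x -> l x = x `^ rho.
Proof.
move=> l_gt0 lM l_nd.
pose phi t := ln (l (expR t)).
have phiE : forall t, phi t = t * phi 1.
  apply: additive_nondecreasing_linear => x y.
    by rewrite /phi expRD lM ?expR_gt0 // lnM // posrE l_gt0 ?expR_gt0.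
  by move=> xy; rewrite /phi ler_ln ?posrE ?l_gt0 ?expR_gt0 // l_nd ?expR_gt0 ?ler_expR.
exists (phi 1).
  have l1 : l 1 = 1.
    by apply: (mulfI (lt0r_neq0 (l_gt0 1 ltr01))); rewrite -lM // !mulr1.
  rewrite /phi ln_ge0 // -[leLHS]l1 l_nd //; have := expR_ge1Dx (1 : R); lra.
move=> x x0; rewrite /powR gt_eqF // mulrC -phiE /phi !lnK ?posrE //.
by rewrite l_gt0.
Qed.

(* Divide by [v `^ (1 + rho)], use [expR y >= 1 + y], then [ln r >= 1 - 1 / r]. *)
Lemma powR_tangent (R : realType) (rho u v : R) : 0 <= rho -> 0 <= u -> 0 < v ->
  (1 + rho) * (u * v `^ rho) <= u * u `^ rho + rho * (v * v `^ rho).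
Proof.
move=> rho0 u0 v0; move: u0; rewrite [0 <= u]le_eqVlt => /predU1P[<-|u0].
  by rewrite !mul0r mulr0 add0r !mulr_ge0 ?powR_ge0 // ltW.
have -> : u = (u / v) * v by rewrite divfK // gt_eqF.
have : 0 < u / v by rewrite divr_gt0.
move: (u / v) => r r0.
rewrite (powRM _ (ltW r0) (ltW v0)).
have lnr : 1 - r^-1 <= ln r.
  have := @le_ln1Dx R (r^-1 - 1); rewrite (addrC 1) subrK lnV ?posrE //.
  have : 0 < r^-1 by rewrite invr_gt0.
  by move=> ri0 /(_ _); lra.
have rp : 1 + rho * (1 - r^-1) <= r `^ rho.
  rewrite /powR gt_eqF //; apply: le_trans (expR_ge1Dx _).
  by rewrite lerD2l ler_wpM2l.
have {}rp : (1 + rho) * r <= r * r `^ rho + rho.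
  have := ler_wpM2l (ltW r0) rp.
  have rr : r * r^-1 = 1 by rewrite divff // gt_eqF.
  have -> : r * (1 + rho * (1 - r^-1)) = r + rho * r - rho * (r * r^-1) by ring.
  rewrite rr; lra.
have := ler_wpM2r (mulr_ge0 (ltW v0) (powR_ge0 v rho)) rp.
lra.
Qed.

(** * Limits at 0 and the index of regular variation *)

Lemma cvg_at_right0M (R : realType) (k : R) : 0 < k ->
  t * k @[t --> 0^'+] --> 0^'+.
Proof.
move=> k0 A [e /= e0 hA]; exists (e / k) => /=; first by rewrite divr_gt0.
move=> t /= te t0; apply: hA => /=; last by rewrite mulr_gt0.
by move: te; rewrite !sub0r !normrN normrM (gtr0_norm k0) ltr_pdivlMr.
Qed.

(** The ratio factors as [g (t * x) / c (t * x)] times [c (t * x) / c t]. *)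
Lemma cvg_ratio_scale (R : realType) (g c : R -> R) (a x l : R) :
  (forall x : R, 0 < x -> 0 < c x) -> 0 < x ->
  g t / c t @[t --> 0^'+] --> a -> c (t * x) / c t @[t --> 0^'+] --> l ->
  g (t * x) / c t @[t --> 0^'+] --> a * l.
Proof.
move=> c_gt0 x0 ga cl.
apply: cvg_trans (cvgM (cvg_comp _ _ (cvg_at_right0M x0) ga) cl).
apply: near_eq_cvg; near=> t => /=.
have t0 : 0 < t by near: t; exact: nbhs_right_gt.
have := c_gt0 _ (mulr_gt0 t0 x0); have := c_gt0 _ t0 => ct ctx.
by rewrite /= mulrA divfK // gt_eqF.
Unshelve. all: by end_near. Qed.

(* [g] is a monotone function comparable to [c]; it stands in for the
   monotonicity or measurability of [c] that regular variation usually requires. *)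
Lemma regvar0_powR (R : realType) (c g : R -> R) (a : R) :
  (forall x : R, 0 < x -> 0 < c x) -> regvar0 c ->
  (forall x y : R, 0 <= x -> x <= y -> g x <= g y) -> 0 < a ->
  g t / c t @[t --> 0^'+] --> a ->
  exists2 rho, 0 <= rho &
    forall x : R, 0 < x -> c (t * x) / c t @[t --> 0^'+] --> x `^ rho.
Proof.
move=> c_gt0 c_rv g_nd a0 ga.
have /choice[l lP] : forall x, exists l,
    0 < x -> l != 0 /\ c (t * x) / c t @[t --> 0^'+] --> l.
  move=> x; case: (ltP 0 x) => [/c_rv[l lP]|x0]; first by exists l.
  by exists 0.
have l_gt0 x : 0 < x -> 0 < l x.
  move=> x0; have [l0 cl] := lP x x0; rewrite lt_def l0 /=.
  apply: (ler_cvg_to (cvg_cst 0) cl); near=> t => /=.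
  have t0 : 0 < t by near: t; exact: nbhs_right_gt.
  by rewrite divr_ge0 // ltW // c_gt0 // mulr_gt0.
have [rho rho0 lE] : exists2 rho, 0 <= rho & forall x : R, 0 < x -> l x = x `^ rho.
  apply: multiplicative_nondecreasing_powR => // x y x0.
    move=> y0; have [_ clx] := lP _ x0; have [_ cly] := lP _ y0.
    have [_ clxy] := lP _ (mulr_gt0 x0 y0).
    rewrite (mulrC (l x)); apply: (norm_cvg_unique clxy) => /=.
    rewrite (_ : (fun t => _) = fun t => c (t * x * y) / c t); last first.
      by apply/funext => t; rewrite mulrA.
    exact: (@cvg_ratio_scale _ (fun t => c (t * y)) c _ _ _ c_gt0 x0 cly clx).
  move=> xy; have y0 := lt_le_trans x0 xy.
  have [_ clx] := lP _ x0; have [_ cly] := lP _ y0.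
  (* [a * l x] is the limit of [g (t * x) / c t], so [l] inherits the monotonicity of [g]. *)
  rewrite -(ler_pM2l a0).
  apply: (ler_cvg_to (cvg_ratio_scale c_gt0 x0 ga clx) (cvg_ratio_scale c_gt0 y0 ga cly)).
  near=> t => /=.
  have t0 : 0 < t by near: t; exact: nbhs_right_gt.
  rewrite ler_pM2r ?invr_gt0 ?c_gt0 // g_nd ?(ltW (mulr_gt0 _ _)) //.
  by rewrite ler_pM2l.
by exists rho => // x x0; rewrite -lE //; have [] := lP _ x0.
Unshelve. all: by end_near. Qed.

(** * Asymptotics of a single edge cost *)

Section Edge.
Variables (R : realType) (c g : R -> R) (rho : R).
Hypothesis c_gt0 : forall x : R, 0 < x -> 0 < c x.
Hypothesis rho_ge0 : 0 <= rho.
Hypothesis c_powR :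
  forall x : R, 0 < x -> c (t * x) / c t @[t --> 0^'+] --> x `^ rho.
Hypothesis g_nd : forall x y : R, 0 <= x -> x <= y -> g x <= g y.
Hypothesis g_ge0 : forall x : R, 0 <= x -> 0 <= g x.

(** For [z <= t * d] the error term absorbs the left side. Beyond, [g z >= g (t * d)], which is at
    least [(1 + rho) * K * c t] because [g / c] blows up while [c (t * d)] stays comparable to
    [c t]. *)
Lemma near_tangent_infinite (K eps : R) : 0 <= K -> 0 < eps ->
  (g t / c t)%:E @[t --> 0^'+] --> +oo%E ->
  \forall t \near 0^'+, forall x z w : R, 0 <= x -> 0 <= z <= t -> w <= K * c t ->
    (1 + rho) * (z * w) <= z * g z + rho * (x * g x) + eps * (t * c t).
Proof.
move=> K0 eps0 /cvgeyPge goo.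
have s0 : 0 < 1 + rho by rewrite ltr_pwDl.
(* Chosen so that [(1 + rho) * (K + 1) * d = eps]; [K] itself may be 0. *)
pose d := eps / ((1 + rho) * (K + 1)).
have d0 : 0 < d by rewrite divr_gt0 // mulr_gt0 //; lra.
pose l := d `^ rho; have l0 : 0 < l by rewrite powR_gt0.
near=> t => x z w x0 /andP[z0 zt] wK.
have t0 : 0 < t by near: t; exact: nbhs_right_gt.
have ct := c_gt0 t0.
have xg : 0 <= rho * (x * g x) by rewrite !mulr_ge0 ?g_ge0.
have tc : 0 < eps * (t * c t) by rewrite !mulr_gt0.
have zg : 0 <= z * g z by rewrite mulr_ge0 ?g_ge0.
have zw : (1 + rho) * (z * w) <= (1 + rho) * (z * (K * c t)).
  by rewrite ler_pM2l // ler_wpM2l.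
apply: le_trans zw _.
case: (lerP z (t * d)) => [ztd|tdz].
  suff : (1 + rho) * (z * (K * c t)) <= eps * (t * c t) by lra.
  have -> : eps * (t * c t) = (1 + rho) * ((t * d) * ((K + 1) * c t)).
    by rewrite /d; field; rewrite !gt_eqF //; lra.
  rewrite ler_pM2l // ler_pM ?mulr_ge0 // ?(ltW ct) //.
  by rewrite ler_pM2r //; lra.
suff : z * ((1 + rho) * K * c t) <= z * g z by lra.
rewrite ler_wpM2l //; apply: le_trans (g_nd (ltW (mulr_gt0 t0 d0)) (ltW tdz)).
have td0 := mulr_gt0 t0 d0.
have h1 : l / 2 * c t <= c (t * d).
  rewrite -ler_pdivlMr //; apply: ltW; near: t.
  apply: cvgr_gt (c_powR d0) _ _; rewrite /= -/l; lra.
have h2 : (1 + rho) * K * (2 / l) * c (t * d) <= g (t * d).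
  rewrite -ler_pdivlMr ?c_gt0 // -lee_fin; near: t.
  exact: (cvg_at_right0M d0 (goo ((1 + rho) * K * (2 / l)))).
apply: le_trans h2.
rewrite [leLHS](_ : _ = (1 + rho) * K * (2 / l) * (l / 2 * c t)); last first.
  by field; rewrite gt_eqF.
by rewrite ler_wpM2l // !mulr_ge0 ?invr_ge0 // ltW.
Unshelve. all: by end_near. Qed.

(* The ratios [g (t * q) / c t] are controlled uniformly in [q] by sampling [q]
   on a grid of step [1 / N]: monotonicity of [g] handles the points in between. *)
Lemma near_tangent_finite (a eps : R) : 0 < eps ->
  g t / c t @[t --> 0^'+] --> a ->
  \forall t \near 0^'+, forall x z w : R, 0 <= x <= t -> 0 <= z <= t -> w <= g x ->
    (1 + rho) * (z * w) <= z * g z + rho * (x * g x) + eps * (t * c t).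
Proof.
move=> eps0 ga.
have s0 : 0 < 1 + rho by rewrite ltr_pwDl.
have a0 : 0 <= a.
  apply: (ler_cvg_to (cvg_cst 0) ga); near=> t => /=.
  have t0 : 0 < t by near: t; exact: nbhs_right_gt.
  by rewrite divr_ge0 ?g_ge0 ?(ltW t0) // ltW // c_gt0.
(* [L] bounds the slope of [a * q * q ^ rho] on [[0, 2]], so [L / N] bounds its change over one grid
   step. *)
pose s := 1 + rho; pose L := s * (a * 2 `^ rho).
have L0 : 0 <= L by rewrite !mulr_ge0 ?powR_ge0 // ltW.
have [N N0 NL] : exists2 N : nat, (0 < N)%N & s * L <= eps / 2 * N%:R.
  exists (Num.trunc (2 * s * L / eps)).+1 => //.
  have /truncn_itv/andP[_] : 0 <= 2 * s * L / eps.
    by rewrite divr_ge0 ?mulr_ge0 // ltW.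
  by rewrite ltr_pdivrMr //; lra.
have NR : (0 : R) < N%:R by rewrite ltr0n.
pose q (k : nat) : R := k%:R / N%:R.
have q_ge0 k : 0 <= q k by rewrite divr_ge0.
have q_gt0 k : 0 < q k.+1 by rewrite divr_gt0 ?ltr0n.
have qS k : q k.+1 = q k + N%:R^-1 by rewrite /q -natr1; field; rewrite gt_eqF.
(* The cell starting at [u = t] is number [N], so right endpoints reach index [N + 1] and exceed
   1. *)
have q_le2 k : (k <= N)%N -> q k.+1 <= 2.
  move=> kN; rewrite ler_pdivrMr // -natrM ler_nat mulnC muln2 -addnn -addn1.
  by rewrite leq_add.
pose H k := a * q k `^ rho.
have H0 k : 0 <= H k by rewrite mulr_ge0 ?powR_ge0.
(* Error budget: [s * eta] occurs three times, costing [eps / 2]; the grid step costs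
   [s * (L / N) <= eps / 2]. *)
pose eta := eps / (6 * s).
have eta0 : 0 < eta by rewrite divr_gt0 // mulr_gt0.
near=> t => x z w /andP[x0 xt] /andP[z0 zt] wx.
have t0 : 0 < t by near: t; exact: nbhs_right_gt.
have ct := c_gt0 t0.
have gH (k : nat) : (0 < k <= N.+1)%N -> `|H k - g (t * q k) / c t| < eta.
  rewrite -ltnS => /andP[k0 kN].
  have : forall i : 'I_N.+1, `|H i.+1 - g (t * q i.+1) / c t| < eta.
    near: t; apply: filter_forall => i.
    have /cvgrPdist_lt := cvg_ratio_scale c_gt0 (q_gt0 i) ga (c_powR (q_gt0 i)).
    exact.
  by case: k k0 kN => // k _ kN /(_ (Ordinal (kN : (k < N.+1)%N))).
have grid u : 0 <= u -> u <= t -> exists k,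
    [/\ (k <= N)%N, t * q k <= u & u <= t * q k.+1].
  move=> u0 ut; exists (Num.trunc (u / t * N%:R)).
  have /truncn_itv/andP[] : 0 <= u / t * N%:R.
    by rewrite !mulr_ge0 ?invr_ge0 // ltW.
  set k := Num.trunc _ => k1 k2; split.
  - rewrite -ltnS -(ltr_nat R); apply: le_lt_trans k1 _.
    apply: (@le_lt_trans _ _ N%:R); last by rewrite ltr_nat.
    by rewrite ger_pMl // ler_pdivrMr // mul1r.
  - by rewrite mulrC -ler_pdivlMr // ler_pdivrMr.
  - by rewrite mulrC -ler_pdivrMr // ler_pdivlMr // ltW.
have low u k : (k <= N)%N -> 0 <= u -> t * q k <= u ->
    (q k.+1 * H k.+1 - L / N%:R - eta) * (t * c t) <= u * g u.
  move=> kN u0 ku.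
  have qk1 : q k <= 1 by rewrite ler_pdivrMr // mul1r ler_nat.
  have qk2 := q_le2 _ kN.
  (* The tangent inequality between neighbouring grid points moves the lower bound from the left
     endpoint to the right one, at the price [L / N]. *)
  have tan := ler_wpM2l a0 (powR_tangent rho_ge0 (q_ge0 k) (q_gt0 k)).
  have step : q k.+1 * H k.+1 - L / N%:R <= q k * H k.
    have : s * H k.+1 / N%:R <= L / N%:R.
      rewrite ler_pM2r ?invr_gt0 // ler_pM2l // ler_wpM2l //.
      by rewrite ge0_ler_powR // nnegrE // ltW.
    move: tan; rewrite /H /s.
    have -> : q k = q k.+1 - N%:R^-1 by rewrite qS addrK.
    lra.
  apply: (@le_trans _ _ ((t * q k) * g (t * q k))); last first.
    by rewrite ler_pM ?g_ge0 ?g_nd // mulr_ge0 // ltW.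
  apply: (@le_trans _ _ ((q k * H k - eta) * (t * c t))).
    by rewrite ler_pM2r ?mulr_gt0 // lerD2r.
  (* Index 0 is not sampled by [gH], but there [q 0 = 0] and the claim reduces to
     [- eta * (t * c t) <= 0]. *)
  case: k kN qk1 {ku qk2 tan step} => [|k] kN qk1.
    rewrite /q mul0r !(mul0r, mulr0) sub0r mulNr oppr_le0.
    exact: ltW (mulr_gt0 eta0 (mulr_gt0 t0 ct)).
  have := gH k.+1 (ltnW kN); rewrite ltr_distlC => /andP[hk _].
  have -> : t * q k.+1 * g (t * q k.+1) =
      q k.+1 * (g (t * q k.+1) / c t) * (t * c t) by field; rewrite gt_eqF.
  rewrite ler_pM2r ?mulr_gt0 //; apply: le_trans (ler_wpM2l (q_ge0 _) (ltW hk)).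
  rewrite mulrBr lerD2l lerN2; apply: ler_piMl => //; exact: ltW.
have [k [kN kz zk]] := grid z z0 zt; have [j [jN jx xj]] := grid x x0 xt.
have up : z * w <= (q k.+1 * H j.+1 + 2 * eta) * (t * c t).
  apply: (@le_trans _ _ (t * q k.+1 * g (t * q j.+1))).
    apply: (@le_trans _ _ (z * g (t * q j.+1))).
      by rewrite ler_wpM2l // (le_trans wx) // g_nd.
    by rewrite ler_wpM2r // g_ge0 // mulr_ge0 // ltW.
  have := gH j.+1 jN; rewrite ltr_distlC => /andP[_ hj].
  have -> : t * q k.+1 * g (t * q j.+1) =
      q k.+1 * (g (t * q j.+1) / c t) * (t * c t) by field; rewrite gt_eqF.
  rewrite ler_pM2r ?mulr_gt0 //; apply: le_trans (ler_wpM2l (q_ge0 _) (ltW hj)) _.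
  by rewrite mulrDr lerD2l ler_pM2r ?q_le2.
(* All estimates now refer to right endpoints, where the exact inequality for powers compares
   them. *)
have tan := ler_wpM2l a0 (powR_tangent rho_ge0 (q_ge0 k.+1) (q_gt0 j)).
have lowz := low _ _ kN z0 kz; have lowx := ler_wpM2l rho_ge0 (low _ _ jN x0 jx).
have seta : s * eta = eps / 6 by rewrite /eta; field; rewrite gt_eqF.
have sL : s * (L / N%:R) <= eps / 2 by rewrite mulrA ler_pdivrMr.
have : s * (q k.+1 * H j.+1 + 2 * eta) <= q k.+1 * H k.+1 - L / N%:R - eta +
    rho * (q j.+1 * H j.+1 - L / N%:R - eta) + eps.
  move: tan seta sL; rewrite /H /s; lra.
move=> /(ler_wpM2r (ltW (mulr_gt0 t0 ct))).
have := ler_wpM2l (ltW s0) up; move: lowz lowx; rewrite -/s.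
move: (t * c t) => T; lra.
Unshelve. all: by end_near. Qed.

(** Meant for [x] an equilibrium load, [z] a competing load and [w] the equilibrium edge cost
    truncated at the path cost. Finite [alpha] calls on [w <= g x], infinite [alpha] on
    [w <= K * c t]. *)
Lemma near_tangent (K eps : R) (alpha : \bar R) : 0 <= K -> 0 < eps ->
  (g t / c t)%:E @[t --> 0^'+] --> alpha ->
  \forall t \near 0^'+, forall x z w : R, 0 <= x <= t -> 0 <= z <= t ->
    w <= g x -> w <= K * c t ->
    (1 + rho) * (z * w) <= z * g z + rho * (x * g x) + eps * (t * c t).
Proof.
move=> K0 eps0; case: alpha => [a /fine_cvgP[_ ga]|goo|/cvgeNyPle/(_ (-1)) goo].
- near=> t => x z w xt zt wx _; move: x z w xt zt wx; near: t.
  exact: near_tangent_finite ga.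
- near=> t => x z w /andP[x0 _] zt _ wK; move: x z w x0 zt wK; near: t.
  exact: near_tangent_infinite goo.
- near=> t.
  have t0 : 0 < t by near: t; exact: nbhs_right_gt.
  have : ((g t / c t)%:E <= (-1)%:E)%E by near: t.
  have := divr_ge0 (g_ge0 (ltW t0)) (ltW (c_gt0 t0)); rewrite lee_fin; lra.
Unshelve. all: by end_near. Qed.

(** Meant for [k] the share of demand on a heavily used path: it bounds the equilibrium cost below
    by a multiple of [c t]. *)
Lemma near_ratio_ge (k : R) (alpha : \bar R) : 0 < k -> (0 < alpha)%E ->
  (g t / c t)%:E @[t --> 0^'+] --> alpha ->
  exists2 kappa, 0 < kappa & \forall t \near 0^'+, kappa * c t <= g (t * k).
Proof.
move=> k0 alpha0 ga.
have [b b0 gb] : exists2 b, 0 < b & \forall t \near 0^'+, b <= g t / c t.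
  case: alpha alpha0 ga => [a|_ /cvgeyPge/(_ 1) g1|//].
    rewrite lte_fin => a0 /fine_cvgP[_ ga]; exists (a / 2); first by rewrite divr_gt0.
    near=> t; apply: ltW; near: t; apply: (cvgr_gt a) => //; lra.
  by exists 1 => //; near=> t; rewrite -lee_fin; near: t.
pose l := k `^ rho; have l0 : 0 < l by rewrite powR_gt0.
exists (b * (l / 2)); first by rewrite !mulr_gt0.
near=> t.
have t0 : 0 < t by near: t; exact: nbhs_right_gt.
have ct := c_gt0 t0; have ctk := c_gt0 (mulr_gt0 t0 k0).
apply: (@le_trans _ _ (b * c (t * k))).
  rewrite -mulrA ler_pM2l // -ler_pdivlMr //; apply: ltW; near: t.
  apply: cvgr_gt (c_powR k0) _ _; rewrite -/l; lra.
rewrite -ler_pdivlMr //; near: t.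
exact: (cvg_at_right0M k0 gb).
Unshelve. all: by end_near. Qed.

Lemma near_ratio_le (alpha : \bar R) : (alpha < +oo)%E ->
  (g t / c t)%:E @[t --> 0^'+] --> alpha ->
  exists2 K, 0 <= K & \forall t \near 0^'+, g t <= K * c t.
Proof.
move=> alphaoo ga.
have [b gb] : exists b, \forall t \near 0^'+, g t / c t <= b.
  case: alpha alphaoo ga => [a|//|_ /cvgeNyPle/(_ 1) g1].
    move=> _ /fine_cvgP[_ ga]; exists (a + 1).
    near=> t; apply: ltW; near: t; apply: (cvgr_lt a) => //; lra.
  by exists 1; near=> t; rewrite -lee_fin; near: t.
exists `|b| => //; near=> t.
have t0 : 0 < t by near: t; exact: nbhs_right_gt.
rewrite -ler_pdivrMr ?c_gt0 //; apply: le_trans (ler_norm _); near: t; exact: gb.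
Unshelve. all: by end_near. Qed.
End Edge.

(** * Loads and equilibria at a fixed demand *)

Section Routing.
Variables (R : realType) (E : finType) (P : seq (seq E)) (ce : E -> R -> R).
Implicit Types (f h : seq E -> R) (p : seq E).

(** Exchange of summation; with edge costs for [w] it turns social cost into flow-weighted path
    costs. *)
Lemma sum_loadM f (w : E -> R) :
  \sum_e load P f e * w e = \sum_(p <- P) f p * \sum_(e | e \in p) w e.
Proof.
rewrite /load; under eq_bigr do rewrite big_distrl.
rewrite (exchange_big_dep xpredT) //=.
by apply: eq_bigr => p _; rewrite big_distrr.
Qed.

Lemma le_load M f p e : feasible P M f -> p \in P -> e \in p -> f p <= load P f e.
Proof.
move=> [f0 _] pP ep; rewrite /load (big_rem p) //= ep lerDl big_seq_cond sumr_ge0 //.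
by move=> q /andP[/mem_rem/f0].
Qed.

Lemma load_itv M f e : feasible P M f -> 0 <= load P f e <= M.
Proof.
move=> [f0 <-]; rewrite /load big_seq_cond sumr_ge0 /=; last by move=> p /andP[/f0].
rewrite -big_seq_cond [leRHS](bigID (fun p => e \in p)) /= lerDl big_seq_cond sumr_ge0 //.
by move=> p /andP[/f0].
Qed.

Lemma feasible_large_path M f : 0 < M -> feasible P M f ->
  exists2 p, p \in P & M / (size P)%:R <= f p.
Proof.
move=> M0 [f0 fM]; apply: contrapT => nP.
have lt p : p \in P -> f p < M / (size P)%:R.
  by move=> pP; rewrite ltNge; apply/negP => h; apply: nP; exists p.
have P0 : P != [::] by apply: contraTneq M0 => P0; rewrite -fM P0 big_nil ltxx.
have : \sum_(p <- P) f p < \sum_(p <- P) M / (size P)%:R.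
  rewrite big_seq [ltRHS]big_seq; apply: ltr_sum => //.
  by case: P P0 => // p s _; rewrite /= mem_head.
rewrite fM big_const_seq count_predT iter_addr_0 -[_ *+ _]mulr_natr.
by rewrite divfK ?ltxx // pnatr_eq0 size_eq0.
Qed.

Hypothesis ce_ge0 : forall e x, 0 <= x -> 0 <= ce e x.

Lemma pcost_ge M f p e : feasible P M f -> e \in p -> ce e (load P f e) <= pcost P ce f p.
Proof.
move=> fF ep; rewrite /pcost (bigD1 e) //= lerDl sumr_ge0 // => e' _.
by have /andP[l0 _] := load_itv e' fF; exact: ce_ge0.
Qed.

Lemma wardrop_social M f p : wardrop P ce M f -> p \in P -> 0 < f p ->
  social P ce f = pcost P ce f p * M.
Proof.
move=> [[f0 fM] fW] pP fp; rewrite /social sum_loadM -fM mulrC big_distrl /=.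
rewrite big_seq [RHS]big_seq; apply: eq_bigr => q qP.
have := f0 q qP; rewrite le_eqVlt => /predU1P[<-|fq]; first by rewrite !mul0r.
by congr (_ * _); apply/eqP; rewrite eq_le !fW.
Qed.

(* Truncating the edge costs at the equilibrium path cost leaves the equilibrium
   unchanged and tames the costs of unused edges. *)
Lemma wardrop_variational M f h p : wardrop P ce M f -> p \in P -> 0 < f p ->
  feasible P M h ->
  pcost P ce f p * M <=
  \sum_e load P h e * Num.min (ce e (load P f e)) (pcost P ce f p).
Proof.
move=> [fF fW] pP fp [h0 hM]; rewrite sum_loadM -{1}hM mulrC big_distrl /=.
have min_ge0 e : 0 <= Num.min (ce e (load P f e)) (pcost P ce f p).
  have ge0 e' : 0 <= ce e' (load P f e').
    by have /andP[l0 _] := load_itv e' fF; exact: ce_ge0.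
  by rewrite le_min ge0 sumr_ge0.
rewrite big_seq [leRHS]big_seq; apply: ler_sum => q qP.
apply: ler_wpM2l; first exact: h0.
(* If an edge of [q] costs more than the path [p], its truncated cost alone equals that of [p].
   Otherwise nothing on [q] is truncated and the equilibrium condition applies. *)
have [/existsP[e /andP[eq lt]]|/existsPn all_le] :=
  boolP [exists e, (e \in q) && (pcost P ce f p < ce e (load P f e))].
  rewrite (bigD1 e) //= {1}/Num.min ltNge (ltW lt) /= lerDl sumr_ge0 //.
apply: (le_trans (fW _ _ pP qP fp)); apply: ler_sum => e eq.
by have := all_le e; rewrite eq /= -leNgt le_min lexx.
Qed.
End Routing.

(** * Bounds on the price of anarchy, and consequences of tightness *)

Lemma opt_le_social (R : realType) (E : finType) (P : seq (seq E))
    (ce : E -> R -> R) (M : R) (f : seq E -> R) :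
  (forall e x, 0 <= x -> 0 <= ce e x) -> feasible P M f ->
  opt P ce M <= social P ce f.
Proof.
move=> ce_ge0 fF; apply: ge_inf; last by exists f.
exists 0 => _ [h hF <-]; apply: sumr_ge0 => e _.
by have /andP[l0 _] := load_itv e hF; rewrite mulr_ge0 ?ce_ge0.
Qed.

(** The lower bound passes to the infimum, and [(1 + 2 * eta) * (1 - eta) >= 1] for
    [eta <= 1 / 2]. *)
Lemma poa_dist1_le (R : realType) (E : finType) (P : seq (seq E))
    (ce : E -> R -> R) (M eta : R) (f : seq E -> R) :
  (forall e x, 0 <= x -> 0 <= ce e x) -> feasible P M f ->
  0 < social P ce f -> 0 < eta <= 2^-1 ->
  (forall h, feasible P M h -> (1 - eta) * social P ce f <= social P ce h) ->
  `|poa P ce M f - 1| <= 2 * eta.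
Proof.
move=> ce_ge0 fF S0 /andP[eta0 eta2] lb.
have optS := opt_le_social ce_ge0 fF.
have lo : (1 - eta) * social P ce f <= opt P ce M.
  apply: lb_le_inf; first by exists (social P ce f), f.
  by move=> _ [h hF <-]; exact: lb.
have O0 : 0 < opt P ce M by apply: lt_le_trans lo; rewrite mulr_gt0 //; lra.
rewrite /poa gt_eqF // ger0_norm ?subr_ge0 ?ler_pdivlMr ?mul1r //.
rewrite lerBlDr ler_pdivrMr //.
apply: (@le_trans _ _ ((2 * eta + 1) * ((1 - eta) * social P ce f))).
  rewrite mulrA ler_peMl ?(ltW S0) //; nra.
by rewrite ler_wpM2l //; lra.
Qed.

(** Supplies the reference path whose cost bounds the equilibrium cost from above. *)
Lemma tightness_lty (R : realType) (E : finType) (P : seq (seq E)) (alpha : E -> \bar R) :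
  (tightness P alpha < +oo)%E ->
  exists2 p, p \in P & forall e, e \in p -> (alpha e < +oo)%E.
Proof.
rewrite /tightness; elim: P => [|p P IH]; first by rewrite big_nil ltxx.
rewrite big_cons gt_min => /orP[lty|/IH[q qP lty]]; last first.
  by exists q => //; rewrite inE qP orbT.
exists p => [|e ep]; first exact: mem_head.
by apply: le_lt_trans lty; exact: le_bigmax_cond.
Qed.

Lemma tightness_gt0 (R : realType) (E : finType) (P : seq (seq E)) (alpha : E -> \bar R) p :
  (0 < tightness P alpha)%E -> p \in P -> exists2 e, e \in p & (0 < alpha e)%E.
Proof.
move=> T0 pP.
have : (0 < \big[maxe/-oo]_(e : E | e \in p) alpha e)%E.
  by apply: lt_le_trans T0 _; exact: ge_bigmin_seq.
by case/bigmax_gtP.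
Qed.

Theorem theorem4p2 (R : realType) (V E : finType) (tl hd : E -> V) (o d : V)
    (P : seq (seq E)) (ce : E -> R -> R) (c : R -> R) (alpha : E -> \bar R) :
  o != d ->
  P != [::] -> uniq P ->
  (forall p, p \in P -> is_od_path tl hd o d p) ->
  (forall e, cost_fun (ce e)) ->
  (forall x, 0 < x -> 0 < c x) ->
  regvar0 c ->
  (forall e, (fun x => ((ce e x) / c x)%:E) @ 0^'+ --> alpha e) ->
  (0 < tightness P alpha < +oo)%E ->
  forall eps : R, 0 < eps ->
  exists2 delta : R, 0 < delta &
    forall (M : R) (f : seq E -> R), 0 < M < delta -> wardrop P ce M f ->
      `|poa P ce M f - 1| < eps.
Proof.
move=> _ P0 _ _ ce_cost c_gt0 c_rv ce_alpha /andP[tight_gt0 tight_lty] eps eps0.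
have ce_nd e : forall x y : R, 0 <= x -> x <= y -> ce e x <= ce e y.
  by case: (ce_cost e) => _ [].
have ce_ge0 e : forall x : R, 0 <= x -> 0 <= ce e x by case: (ce_cost e) => _ [].
have [p0 p0P p0_lty] := tightness_lty tight_lty.
have [rho rho0 c_powR] : exists2 rho, 0 <= rho &
    forall x : R, 0 < x -> c (t * x) / c t @[t --> 0^'+] --> x `^ rho.
  (* An edge of [p0] with positive limit also has a finite one, so its cost is a monotone function
     comparable to [c]. *)
  have [e0 e0p e0_gt0] := tightness_gt0 tight_gt0 p0P.
  have := p0_lty _ e0p; have := ce_alpha e0; move: e0_gt0.
  case: (alpha e0) => [a|//|//]; rewrite lte_fin => a0 /fine_cvgP[_ ga] _.
  exact: regvar0_powR c_gt0 c_rv (ce_nd e0) a0 ga.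
pose N : R := (size P)%:R; have N0 : 0 < N by rewrite ltr0n lt0n size_eq0.
(* Edges without positive [alpha e] get the default 1, which keeps the minimum [kappa] positive. *)
have /choice[kap kapP] : forall e, exists k, 0 < k /\
    ((0 < alpha e)%E -> \forall t \near 0^'+, k * c t <= ce e (t * N^-1)).
  move=> e; case: (ltP 0%E (alpha e)) => [e0|_]; last by exists 1.
  have Ni : 0 < N^-1 by rewrite invr_gt0.
  have [k k0 kP] := near_ratio_ge c_gt0 c_powR Ni e0 (ce_alpha e).
  by exists k.
have /choice[Ke KeP] : forall e, exists k, 0 <= k /\
    ((alpha e < +oo)%E -> \forall t \near 0^'+, ce e t <= k * c t).
  move=> e; case: (ltP (alpha e) +oo%E) => [e0|_]; last by exists 0.
  have [k k0 kP] := near_ratio_le c_gt0 e0 (ce_alpha e).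
  by exists k.
pose kappa := \big[Num.min/1]_e kap e.
have kappa0 : 0 < kappa by apply: lt_bigmin => // e _; have [] := kapP e.
pose K := \sum_e Ke e.
have K0 : 0 <= K by apply: sumr_ge0 => e _; have [] := KeP e.
pose eta := Num.min 2^-1 (eps / 4).
have eta0 : 0 < eta by rewrite lt_min invr_gt0 ltr0n divr_gt0.
have eta_eps : 2 * eta < eps.
  have : eta <= eps / 4 by rewrite ge_min lexx orbT.
  lra.
have eta2 : eta <= 2^-1 by rewrite ge_min lexx.
pose n : R := #|E|%:R; have n0 : 0 <= n by rewrite ler0n.
(* The [n] edge errors [eps' * (M * c M)] then sum to at most [eta * kappa * (M * c M)], hence to at
   most [eta] times the equilibrium cost. *)
pose eps' := eta * kappa / (n + 1).
have eps'0 : 0 < eps' by rewrite divr_gt0 ?mulr_gt0 // ltr_wpDl.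
have neps' : n * eps' <= eta * kappa.
  by rewrite mulrC /eps' mulrAC ler_pdivrMr ?ltr_wpDl // ler_pM2l ?mulr_gt0 // lerDl.
suff [delta /= delta0 deltaP] : \forall M \near 0^'+, forall f, 0 < M ->
    wardrop P ce M f -> `|poa P ce M f - 1| < eps.
  exists delta => // M f /andP[M0 Md]; apply: deltaP => //=.
  by rewrite sub0r normrN gtr0_norm.
near=> M => f M0 fW; have [fF _] := fW; have cM := c_gt0 M M0.
have [p pP fp] := feasible_large_path M0 fF.
have fp0 : 0 < f p by apply: lt_le_trans fp; rewrite divr_gt0.
pose L := pcost P ce f p.
have L_ge : kappa * c M <= L.
  have [e ep e_gt0] := tightness_gt0 tight_gt0 pP.
  apply: le_trans (pcost_ge ce_ge0 fF ep).
  apply: (@le_trans _ _ (ce e (M * N^-1))); last first.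
    apply: (ce_nd e); first by rewrite divr_ge0 // ltW.
    exact: le_trans fp (le_load fF pP ep).
  apply: (@le_trans _ _ (kap e * c M)).
    by rewrite ler_pM2r //; exact: bigmin_le.
  (* The edge depends on [M] and [f], so the estimate is made for all edges at once before [M] is
     fixed. *)
  move: e {ep} e_gt0; near: M; apply: filter_forall => e.
  have [_ kapeP] := kapP e; case: (ltP 0%E (alpha e)) => [/kapeP|_].
    by apply: filterS.
  exact: nearW.
have L_le : L <= K * c M.
  (* The used path [p] costs no more than [p0], whose edges all carry load at most [M]. *)
  have [_ fmin] := fW; apply: le_trans (fmin _ _ pP p0P fp0) _.
  rewrite /K big_distrl /= [leRHS](bigID (fun e => e \in p0)) /=.
  rewrite -[leLHS]addr0; apply: lerD; last first.
    by apply: sumr_ge0 => e _; rewrite mulr_ge0 ?(ltW cM) //; have [] := KeP e.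
  apply: ler_sum => e ep; have /andP[l0 lM] := load_itv e fF.
  apply: le_trans (ce_nd _ _ _ l0 lM) _.
  move: e {l0 lM} ep; near: M; apply: filter_forall => e.
  case: (boolP (e \in p0)) => [/p0_lty lty|_]; last exact: nearW.
  by have [_ /(_ lty)] := KeP e; apply: filterS.
have S_eq : social P ce f = L * M := wardrop_social fW pP fp0.
have S_gt0 : 0 < social P ce f.
  by rewrite S_eq mulr_gt0 //; apply: lt_le_trans L_ge; rewrite mulr_gt0.
apply: le_lt_trans eta_eps; apply: poa_dist1_le => //; first by rewrite eta0.
move=> h hF.
have : (1 + rho) * (L * M) <=
    social P ce h + rho * social P ce f + n * eps' * (M * c M).
  apply: le_trans (ler_wpM2l _ (wardrop_variational ce_ge0 fW pP fp0 hF)) _.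
    by rewrite addr_ge0.
  rewrite /social [rho * _]mulr_sumr -mulrA mulr_natl -sumr_const mulr_sumr -!big_split /=.
  apply: ler_sum => e _.
  have fI := load_itv e fF; have hI := load_itv e hF.
  have w1 : Num.min (ce e (load P f e)) L <= ce e (load P f e) by rewrite ge_min lexx.
  have w2 : Num.min (ce e (load P f e)) L <= K * c M by rewrite ge_min L_le orbT.
  move: (load P f e) (load P h e) (Num.min _ _) fI hI w1 w2.
  move: e; near: M; apply: filter_forall => e.
  exact: (near_tangent c_gt0 rho0 c_powR (ce_nd e) (ce_ge0 e) K0 eps'0 (ce_alpha e)).
have h1 : n * eps' * (M * c M) <= eta * (L * M).
  have := ler_wpM2r (ltW (mulr_gt0 M0 cM)) neps'.
  have := ler_wpM2l (ltW eta0) (ler_wpM2r (ltW M0) L_ge).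
  lra.
rewrite S_eq; lra.
Unshelve. all: by end_near. Qed.
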